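(* For every $\mathbf{c}=(c_1,\dots,c_n)\in\mathbb{Z}_{>0}^n$, every integer $\ell\ge0$ and every integer $0\le m\le n-1$, \[ W(\ell,n,m+1,\mathbf{c})=\sum_{j=0}^{n}(-1)^j\,P^{\,n-1-m}_{-j+1,\,n-1-j}\sum_{i=0}^{\ell}\rho_{\mathbf{c},j}(i)\binom{m+\ell-i}{m}. \]
   Context: For $\sigma\in\mathfrak{S}_n$, $C(\sigma)$ is its set of cycles (fixed points included; cycles regarded as sets of elements). A weighted permutation is $(\sigma,w)$ with $w:C(\sigma)\to\mathbb{Z}_{\ge0}$, total weight $w(\sigma)=\sum_{\mathfrak{c}}w(\mathfrak{c})$; it is $\mathbf{c}$-compatible if $w(\mathfrak{c})<\sum_{i\in\mathfrak{c}}c_i$ for all $\mathfrak{c}\in C(\sigma)$. $W(\ell,n,m,\mathbf{c})$ is the number of $\mathbf{c}$-compatible weighted permutations $(\sigma,w)$, $\sigma\in\mathfrak{S}_n$ with exactly $m$ cycles and total weight $\ell$. For integers $a,b$ and $s\ge0$, $P^s_{a,b}=\sum_{a\le i_1<\cdots<i_s\le b}i_1\cdots i_s$ (the $s$-th elementary symmetric polynomial evaluated at the integers of $[a,b]$; $P^0_{a,b}=1$, and $P^s_{a,b}=0$ if $s$ exceeds the number of integers in $[a,b]$). $\rho_{\mathbf{c},j}(i)$ is the number of $j$-element subsets $I\subseteq[n]$ with $\sum_{r\in I}c_r=i$ ($\rho_{\mathbf{c},0}(i)=1$ if $i=0$, else $0$). *)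

(* Defs.v *)
From HB Require Import structures.
From mathcomp Require Import all_boot all_order all_algebra all_fingroup.

Set Implicit Arguments.
Unset Strict Implicit.
Unset Printing Implicit Defensive.

Import Order.TTheory GRing.Theory Num.Theory.
Local Open Scope ring_scope.

(* C(s); porbits s contains the singletons of the fixed points of s. *)
Definition cycles (n : nat) (s : 'S_n) : finType :=
  {C : {set 'I_n} | C \in porbits s}.

Definition total_weight (n : nat) (s : 'S_n) (w : cycles s -> nat) : nat :=
  (\sum_C w C)%N.

Definition compatible (n : nat) (c : 'I_n -> nat) (s : 'S_n)
    (w : cycles s -> nat) : bool :=
  [forall C : cycles s, (w C < \sum_(i in val C) c i)%N].

(* Weighted permutations all of whose weights are at most l. The bound makes
   this a finite type, and is automatic when the total weight is l: see
   weight_bounded below. *)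
Definition wperm (l n : nat) : finType :=
  {s : 'S_n & {ffun cycles s -> 'I_l.+1}}.

Definition W (l n m : nat) (c : 'I_n -> nat) : nat :=
  #|[set x : wperm l n |
       [&& #|porbits (tag x)| == m,
           compatible c (fun C => tagged x C)
         & total_weight (fun C => tagged x C) == l]]|.

Lemma weight_bounded (l n : nat) (s : 'S_n) (w : cycles s -> nat) :
  total_weight w = l ->
  exists! v : {ffun cycles s -> 'I_l.+1}, forall C, v C = w C :> nat.
Proof.
move=> wl.
have wle C : (w C < l.+1)%N.
  by rewrite ltnS -wl /total_weight (bigD1 C) //= leq_addr.
exists [ffun C => Ordinal (wle C)]; split=> [C|v vE]; first by rewrite ffunE.
by apply/ffunP=> C; apply/val_inj; rewrite ffunE /= vE.
Qed.

Definition interval_size (a b : int) : nat :=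
  if a <= b then absz (b - a + 1) else 0%N.

(* The integers of [a, b] are a + k for k < interval_size a b, and a strictly
   increasing s-tuple of them is given by its s-element set of offsets k. *)
Definition P (s : nat) (a b : int) : int :=
  \sum_(I : {set 'I_(interval_size a b)} | #|I| == s)
    \prod_(k in I) (a + (k : nat)%:Z).

Definition rho (n : nat) (c : 'I_n -> nat) (j i : nat) : nat :=
  #|[set I : {set 'I_n} | (#|I| == j) && (\sum_(r in I) c r == i)%N]|.

(* Main.v *)
Require Import Defs.
From HB Require Import structures.
From mathcomp Require Import all_boot all_order all_algebra all_fingroup.
From mathcomp Require Import zify.

Set Implicit Arguments.
Unset Strict Implicit.
Unset Printing Implicit Defensive.

Import Order.TTheory GRing.Theory Num.Theory.
Local Open Scope ring_scope.

(** Let [x] mark cycles and [t] mark weight. A cycle [C] carries the weight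
    polynomial [(1 - t^c(C)) / (1 - t)], where [c(C)] is the sum of the [c_i]
    over [C], so that [W] is read off from the sum over [s] of the products
    over the cycles [C] of [s] of [x (1 - t^c(C))], with [x / (1 - t)]
    substituted for [x]. Expanding the product amounts to choosing an
    [s]-invariant set [I], the union of the chosen cycles. Such an [s] is a
    pair of permutations of [I] and of its complement, so for [#|I| = j] the
    coefficient of [t^c(I)] is
    [(-1)^j * x (x - 1) .. (x - j + 1) * x (x + 1) .. (x + n - j - 1)], that is,
    [(-1)^j * x] times the product of the [x + k] for
    [1 - j <= k <= n - 1 - j]. *)

(** * Signed cycle enumeration over permutations supported on a set *)

(* Here [y] is the preimage of [z]. *)
Lemma perm_on_insert (T : finType) (A : {set T}) (z : T) (V : nmodType)
    (F : {perm T} -> V) : z \in A ->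
  \sum_(s | perm_on A s) F s =
  \sum_(y in A) \sum_(s | perm_on (A :\ z) s) F (tperm z y * s)%g.
Proof.
move=> zA; rewrite pair_big /=.
(* Composing with the transposition of [z] and its preimage cuts [z] out of its cycle; composing
   again restores [s]. *)
rewrite [RHS](reindex_onto
  (fun s : {perm T} => (s^-1 z, tperm z (s^-1 z) * s)%g)
  (fun p => tperm z p.1 * p.2)%g) /=; last first.
  move=> [y s] /= /andP[yA sA]; have sz : s z = z.
    by rewrite (out_perm sA) // !inE eqxx.
  have sVz : (tperm z y * s)^-1%g z = y.
    by apply: (@perm_inj _ (tperm z y * s)); rewrite permKV permM tpermR sz.
  by rewrite sVz mulgA tperm2 mul1g.
apply: eq_big => [s|s _]; last by rewrite mulgA tperm2 mul1g.
rewrite mulgA tperm2 mul1g eqxx andbT; apply/idP/andP => [sA|[yA sA]].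
  have yA : s^-1%g z \in A by rewrite (perm_closed _ (perm_onV sA)).
  split=> //; apply/subsetP => x; rewrite !inE permM.
  case: tpermP => [->|->|]; rewrite ?permKV ?eqxx //.
    rewrite yA andbT; apply: contraNneq => yz.
    by rewrite yz -{1}yz permKV.
  by move=> /eqP -> _ sxx; rewrite (subsetP sA).
rewrite -[s]mul1g -(tperm2 z (s^-1%g z)) -mulgA.
apply: perm_onM; last by rewrite /perm_on (subset_trans sA) ?subsetDl.
apply: subset_trans (tperm_on _ _) _.
by apply/subsetP => x; rewrite !inE => /orP[] /eqP ->.
Qed.

Lemma permX_fixed (T : finType) (s : {perm T}) k x :
  s x = x -> (s ^+ k)%g x = x.
Proof.
by move=> sx; elim: k => [|k IHk]; rewrite ?perm1 // expgSr permM IHk.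
Qed.

(** A fixed point [z] is a cycle by itself, and the transposition merges it into the cycle of [y]
    when [y] differs from [z]. *)
Lemma card_porbits_tperm_fixed (T : finType) (s : {perm T}) (z y : T) :
  s z = z -> #|porbits s| = (#|porbits (tperm z y * s)| + (z != y))%N.
Proof.
move=> sz; have := porbits_mul_tperm s z y; rewrite /=.
have -> : (z \in porbit s y) = (z == y).
  rewrite porbit_sym; apply/porbitP/eqP => [[k ->]|->].
    by rewrite permX_fixed.
  by exists 0%N; rewrite expg0 perm1.
by case: eqP => _ /=; lia.
Qed.

(* The factor [x ^+ #|A|] avoids dividing by [x] each time a point is inserted
   into an existing cycle. *)
Lemma sum_perm_on_porbits (R : comPzRingType) (x e : R) (T : finType)
    (t : {perm T}) (A : {set T}) :
  e * e = 1 -> (forall z, z \in A -> t z = z) ->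
  x ^+ #|A| *
    (\sum_(s | perm_on A s) e ^+ odd_perm s * x ^+ #|porbits (s * t)|) =
  x ^+ #|porbits t| * \prod_(i < #|A|) (x + e * i%:R).
Proof.
move=> e2; move kE: #|A| => k.
elim: k A kE => [|k IHk] A kE tA.
  rewrite big_ord0 expr0 mul1r mulr1 (big_pred1 1%g) => [|s].
    by rewrite odd_perm1 expr0 mul1r mul1g.
  apply/idP/eqP => [sA|->]; last exact: perm_on1.
  by apply: perm_on_id sA _; rewrite kE.
have [z zA] : exists z, z \in A by apply/card_gt0P; rewrite kE.
have kE' : #|A :\ z| = k by apply/eqP; rewrite -eqSS -kE (cardsD1 z A) zA.
rewrite (perm_on_insert _ zA) big_ord_recr /= mulrA.
rewrite -(IHk (A :\ z)) //; last first.
  by move=> y; rewrite inE => /andP[_]; apply: tA.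
rewrite -mulrA exprSr -mulrA; congr (_ * _).
(* The choice [y = z] changes nothing, so the spare factor [x] survives. Each of the [k] other
   choices flips the sign and loses one cycle: the spare [x] makes up for that cycle and a factor
   [e] remains. The weights add up to [x + e * k]. *)
transitivity (\sum_(y in A) (if y == z then x else e) *
  \sum_(s | perm_on (A :\ z) s) e ^+ odd_perm s * x ^+ #|porbits (s * t)|).
  rewrite mulr_sumr; apply: eq_bigr => y yA.
  rewrite !mulr_sumr; apply: eq_bigr => s sA.
  have stz : (s * t)%g z = z by rewrite permM (out_perm sA) ?tA // !inE eqxx.
  rewrite -mulgA (card_porbits_tperm_fixed y stz) odd_permM odd_tperm eq_sym.
  case: eqVneq => _ /=; first by rewrite addn0 mulrCA.
  rewrite addn1 exprS; case: (odd_perm s) => /=.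
    by rewrite mul1r [RHS]mulrA e2 mul1r.
  by rewrite mul1r mulrCA.
rewrite -mulr_suml mulrC; congr (_ * _).
rewrite (bigD1 z) //= eqxx; congr (_ + _).
rewrite (eq_bigr (fun _ => e)) => [|y /andP[_ /negPf ->] //].
rewrite (eq_bigl (mem (A :\ z))) => [|y]; last by rewrite !inE andbC.
by rewrite sumr_const kE' mulr_natr.
Qed.

(** * Permutations stabilizing a set, and their cycles inside it *)

Section InvariantSets.
Variables (T : finType) (I : {set T}).

Lemma mem_astabs_permP (s : {perm T}) :
  reflect (forall x, (s x \in I) = (x \in I)) (s \in 'N(I | 'P)%g).
Proof. exact: (iffP astabsP). Qed.

(** A permutation stabilizing [I] is the product of its restrictions to [I] and to the complement,
    and every such pair arises. [F] receives the restriction to [I] separately because its sign is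
    needed later. *)
Lemma sum_stab (V : nmodType) (F : {perm T} -> {perm T} -> V) :
  \sum_(s | s \in 'N(I | 'P)%g) F (restr_perm I s) s =
  \sum_(s | perm_on I s) \sum_(t | perm_on (~: I) t) F s (s * t)%g.
Proof.
rewrite pair_big /=.
rewrite [RHS](reindex_onto (fun s => (restr_perm I s, restr_perm (~: I) s))
  (fun p => p.1 * p.2)%g) /=; last first.
  move=> [s t] /= /andP[sI tI].
  have stI : (s * t)%g \in 'N(I | 'P)%g.
    apply/mem_astabs_permP => x; rewrite permM.
    have := perm_closed (s x) tI; rewrite !inE => /negb_inj ->.
    exact: perm_closed.
  have tfix x : x \in I -> t x = x by move=> xI; rewrite (out_perm tI) ?inE ?xI.
  congr pair; apply/permP => x.
    case: (boolP (x \in I)) => xI.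
      by rewrite restr_permE // permM tfix // (perm_closed _ sI).
    by rewrite (out_perm (restr_perm_on _ _)) // (out_perm sI).
  case: (boolP (x \in I)) => xI.
    by rewrite (out_perm (restr_perm_on _ _)) ?inE ?xI // tfix.
  by rewrite restr_permE ?astabsC // ?inE // permM (out_perm sI).
have restrM s : s \in 'N(I | 'P)%g ->
    (restr_perm I s * restr_perm (~: I) s)%g = s.
  move=> sI; apply/permP => x; rewrite permM.
  case: (boolP (x \in I)) => xI.
    rewrite [restr_perm I s x]restr_permE // (out_perm (restr_perm_on _ _)) //.
    by move/mem_astabs_permP: sI => sI; rewrite inE sI xI.
  by rewrite (out_perm (restr_perm_on I _)) // restr_permE ?astabsC // inE.
apply: eq_big => [s|s sI]; last by rewrite restrM.
rewrite !restr_perm_on /=; apply/idP/eqP => [/restrM //|<-].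
apply/mem_astabs_permP => x; rewrite permM.
have := perm_closed (restr_perm I s x) (restr_perm_on (~: I) s).
by rewrite !inE => /negb_inj ->; apply: perm_closed (restr_perm_on _ _).
Qed.

Definition porbits_in (s : {perm T}) := [set C in porbits s | C \subset I].

Lemma porbit_stab (s : {perm T}) : (s \in 'N(I | 'P)%g) ->
  forall x, (porbit s x \subset I) = (x \in I).
Proof.
move=> /mem_astabs_permP sI x; apply/idP/idP => [/subsetP|xI].
  by apply; apply: porbit_id.
apply/subsetP => y /porbitP[k ->].
by elim: k => [|k IHk]; rewrite ?perm1 // expgSr permM sI.
Qed.

Lemma porbit_restr (s : {perm T}) x : (s \in 'N(I | 'P)%g) ->
  porbit (restr_perm I s) x = if x \in I then porbit s x else [set x].
Proof.
move=> sN; have /mem_astabs_permP sI := sN.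
case: ifP => xI; apply/setP => y.
  have sX k : (restr_perm I s ^+ k)%g x = (s ^+ k)%g x /\ (s ^+ k)%g x \in I.
    elim: k => [|k [IH1 IH2]]; first by rewrite !expg0 perm1.
    by rewrite !expgSr !permM IH1 restr_permE // sI.
  by apply/porbitP/porbitP => -[k ->]; exists k; case: (sX k).
rewrite inE; apply/porbitP/eqP => [[k ->]|->]; last first.
  by exists 0%N; rewrite expg0 perm1.
by rewrite permX_fixed // (out_perm (restr_perm_on _ _)) ?xI.
Qed.

(** The restriction fixes every point outside [I], and each of these adds a singleton cycle. *)
Lemma card_porbits_restr (s : {perm T}) : (s \in 'N(I | 'P)%g) ->
  #|porbits (restr_perm I s)| = (#|porbits_in s| + #|~: I|)%N.
Proof.
move=> sN; rewrite -(card_imset (mem (~: I)) (@set1_inj T)).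
have -> : porbits (restr_perm I s) = porbits_in s :|: [set [set x] | x in ~: I].
  apply/setP => C; rewrite !inE; apply/imsetP/orP => [[x _ ->]|[]].
  - rewrite porbit_restr //; case: ifP => xI; [left|right].
      by rewrite porbit_stab // xI andbT imset_f.
    by rewrite imset_f // inE xI.
  - case/andP=> /imsetP[x _ ->]; rewrite porbit_stab // => xI.
    by exists x; rewrite // porbit_restr ?xI.
  - case/imsetP=> x; rewrite inE => /negPf xI ->.
    by exists x; rewrite // porbit_restr ?xI.
rewrite cardsU (_ : _ :&: _ = set0) ?cards0 ?subn0 //.
apply/setP => C; rewrite !inE; apply/negP => /andP[/andP[_ CI] /imsetP[x]].
by rewrite inE => xI CE; move: CI; rewrite CE sub1set (negPf xI).
Qed.

(** A sign is the parity of [#|T|] minus the number of cycles; the fixed points outside [I] count in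
    both and cancel. *)
Lemma sign_porbits_in (R : pzRingType) (s : {perm T}) : s \in 'N(I | 'P)%g ->
  (-1) ^+ #|porbits_in s| =
  (-1) ^+ #|I| * (-1) ^+ odd_perm (restr_perm I s) :> R.
Proof.
move=> sN; rewrite /odd_perm card_porbits_restr // -(cardsC I).
rewrite -oddD signr_odd -exprD -[LHS]signr_odd -[RHS]signr_odd; congr (_ ^+ _).
by rewrite !oddD; do 3!case: (odd _).
Qed.

Lemma mem_cover_porbits_in (s : {perm T}) x :
  (x \in cover (porbits_in s)) = (porbit s x \subset I).
Proof.
apply/bigcupP/idP => [[C]|xI].
  rewrite inE => /andP[/imsetP[y _ ->] yI] xy.
  by move: xy; rewrite -eq_porbit_mem => /eqP ->.
by exists (porbit s x); rewrite ?porbit_id // inE xI imset_f.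
Qed.

(** This is one half of the bijection between sets of cycles of [s] and [s]-invariant sets, by which
    products over cycles are expanded. *)
Lemma cover_porbits_in (s : {perm T}) :
  (cover (porbits_in s) == I) = (s \in 'N(I | 'P)%g).
Proof.
apply/eqP/idP => [cI|sN]; last first.
  by apply/setP => x; rewrite mem_cover_porbits_in porbit_stab.
apply/mem_astabs_permP => x; rewrite -cI !mem_cover_porbits_in.
by have := porbit_perm s 1 x; rewrite expg1 => ->.
Qed.
End InvariantSets.

(** * Expansion over invariant sets and the resulting factorial products *)

Lemma prod_porbits_expand (T : finType) (c : T -> nat) (s : {perm T}) :
  \prod_(C in porbits s) (1 - 'X^(\sum_(i in C) c i)) =
  \sum_(I : {set T} | s \in 'N(I | 'P)%g)
    (-1) ^+ #|porbits_in I s| * 'X^(\sum_(i in I) c i) :> {poly int}.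
Proof.
transitivity (\sum_(U : {set {set T}} | U \subset porbits s)
    (-1) ^+ #|U| * 'X^(\sum_(i in cover U) c i) : {poly int}).
  rewrite big_mkcond /=.
  rewrite (eq_bigr (fun C => (if C \in porbits s then - 'X^(\sum_(i in C) c i)
    else 0) + 1)) => [|C _]; last by case: ifP => _; rewrite ?add0r // addrC.
  rewrite bigA_distr [LHS](bigID (fun U : {set _} => U \subset porbits s)) /=.
  rewrite [X in _ + X]big1 ?addr0 => [|U /subsetPn[C CU /negPf Cs]]; last first.
    by rewrite (bigD1 C) //= CU Cs mul0r.
  apply: eq_bigr => U Us.
  rewrite -big_mkcond /=.
  rewrite (eq_bigr
    (fun C : {set T} => -1 * 'X^(\sum_(i in C) c i) : {poly int})).
    rewrite big_split /= prodr_const prodrXr big_trivIset //.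
    apply: trivIsetS Us _.
    apply/trivIsetP => _ _ /imsetP[x _ ->] /imsetP[y _ ->].
    apply: contraR => /pred0Pn[z /andP[/= zx zy]].
    by move: zx zy; rewrite -!eq_porbit_mem => /eqP <- /eqP <-.
  by move=> C CU; rewrite (subsetP Us) // mulN1r.
(* A set [U] of chosen cycles is recovered from its union as the cycles contained in that union. *)
rewrite (reindex_onto (fun I => porbits_in I s) (@cover T)) /=; last first.
  move=> U Us; apply/setP => C; rewrite inE; apply/andP/idP => [[]|CU].
    case/imsetP=> x _ -> /subsetP /(_ x (porbit_id _ _)) /bigcupP[C' C'U].
    have /imsetP[y _ C'E] := subsetP Us _ C'U.
    by rewrite C'E -eq_porbit_mem => /eqP ->; rewrite -C'E.
  by split; [rewrite (subsetP Us)|apply: bigcup_sup].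
apply: eq_big => [I|I]; rewrite cover_porbits_in.
  by rewrite (_ : _ \subset _) //; apply/subsetP => C; rewrite inE => /andP[].
by case/andP=> _; rewrite -cover_porbits_in => /eqP ->.
Qed.

Lemma sum_stab_porbits (T : finType) (I : {set T}) :
  \sum_(s | s \in 'N(I | 'P)%g)
    (-1) ^+ odd_perm (restr_perm I s) * 'X^#|porbits s| =
  \prod_(i < #|I|) ('X - i%:R) * \prod_(i < #|~: I|) ('X + i%:R) :> {poly int}.
Proof.
rewrite (sum_stab I
  (fun s t => (-1) ^+ odd_perm s * 'X^#|porbits t| : {poly int})).
(* The cancellable factor ['X^#|T|] splits into the powers that [sum_perm_on_porbits] requires on
   [I], with [e = -1], and on [~: I], with [e = 1]. *)
rewrite exchange_big /=; apply: (@mulfI _ ('X^#|T| : {poly int})).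
  by rewrite -size_poly_eq0 size_polyXn.
rewrite -{1}(cardsC I) exprD -[LHS]mulrA [LHS]mulrCA mulr_sumr.
have p1 : #|porbits (1%g : {perm T})| = #|T|.
  rewrite /porbits card_imset // => x y /eqP.
  by rewrite eq_porbit_mem => /porbitP[k ->]; rewrite permX_fixed ?perm1.
have neg2 : (-1) * (-1) = 1 :> {poly int} by rewrite mulrNN mulr1.
rewrite (eq_bigr (fun t : {perm T} => 'X^#|porbits t| *
    \prod_(i < #|I|) ('X - i%:R))) => [|t tI]; last first.
  rewrite (sum_perm_on_porbits 'X neg2) => [|z zI]; last first.
    by rewrite (out_perm tI) // inE zI.
  by congr (_ * _); apply: eq_bigr => i _; rewrite mulN1r.
rewrite -mulr_suml mulrA mulrC.
have := @sum_perm_on_porbits {poly int} 'X 1 T 1 (~: I) (mulr1 1).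
rewrite p1 => /(_ (fun z _ => perm1 z)).
rewrite (eq_bigr (fun t : {perm T} => 'X^#|porbits t|)) => [|t _]; last first.
  by rewrite expr1n mul1r mulg1.
rewrite [X in _ = _ * X](eq_bigr (fun i : 'I__ => 'X + i%:R)) => [|i _];
  last first.
  by rewrite mul1r.
by move=> ->; rewrite mulrCA.
Qed.

(** * Elementary symmetric sums as coefficients *)

Lemma coef_prodXD (N m : nat) (a : 'I_N -> int) : (m <= N)%N ->
  (\prod_(k < N) ('X + (a k)%:P))`_m =
  \sum_(I : {set 'I_N} | #|I| == (N - m)%N) \prod_(k in I) a k.
Proof.
move=> mN; under eq_bigr do rewrite addrC.
rewrite bigA_distr coef_sum [RHS]big_mkcond; apply: eq_bigr => I _.
rewrite (bigID (mem I)) /= (eq_bigr (fun k => (a k)%:P)) => [|k ->] //.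
rewrite [X in _ * X](eq_bigr (fun=> 'X)) => [|k /negPf ->] //.
rewrite -rmorph_prod /= prodr_const coefCM coefXn.
have -> : #|[pred i | i \notin I]| = (N - #|I|)%N.
  by rewrite -[X in (X - _)%N]card_ord -(cardC (mem I)) addKn; apply: eq_card.
have IN : (#|I| <= N)%N by rewrite -[X in (_ <= X)%N]card_ord max_card.
case: (eqVneq #|I| (N - m)%N) => [->|NI]; first by rewrite subKn // eqxx mulr1.
by rewrite (_ : (m == _) = false) ?mulr0 //; apply/eqP; move/eqP: NI; lia.
Qed.

(** The factor ['X] set apart is the term [i = 0] of the rising product if [j = 0], and of the
    falling product otherwise. The remaining shifts run through consecutive integers, the negative
    ones coming from the falling product. *)
Lemma prod_falling_rising (n j : nat) : (0 < n)%N -> (j <= n)%N ->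
  \prod_(i < j) ('X - i%:R) * \prod_(i < n - j) ('X + i%:R) =
  'X * \prod_(k < n.-1) ('X + (1 - j%:Z + (k : nat)%:Z)%:P) :> {poly int}.
Proof.
have natP k : k%:R = (k%:Z)%:P :> {poly int} by rewrite -natz rmorph_nat.
case: n => // n _; case: j => [|j] jn /=.
  rewrite big_ord0 mul1r subn0 big_ord_recl addr0; congr (_ * _).
  apply: eq_bigr => i _; rewrite natP.
  by congr (_ + _%:P); rewrite /= /bump; lia.
rewrite big_ord_recl subr0 -mulrA subSS; congr (_ * _).
rewrite -[RHS](big_mkord xpredT (fun k => 'X + (1 - j.+1%:Z + k%:Z)%:P)).
rewrite (@big_cat_nat _ _ _ j) //=; congr (_ * _).
  rewrite big_nat_rev big_mkord; apply: eq_bigr => i _.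
  rewrite natP -polyCN /=; congr (_ + _%:P).
  by have := ltn_ord i; rewrite /bump; lia.
rewrite -[X in index_iota X]add0n big_addn big_mkord; apply: eq_bigr => i _.
by rewrite natP; congr (_ + _%:P); lia.
Qed.

Lemma P_coef (n m j : nat) : (m < n)%N ->
  P (n - 1 - m) (1 - j%:Z) (n%:Z - 1 - j%:Z) =
  (\prod_(k < n.-1) ('X + (1 - j%:Z + (k : nat)%:Z)%:P))`_m.
Proof.
move=> mn; rewrite coef_prodXD; last by lia.
rewrite /P; have -> : interval_size (1 - j%:Z) (n%:Z - 1 - j%:Z) = n.-1.
  by rewrite /interval_size; case: ifP; lia.
by rewrite subn1.
Qed.

(** * Division by powers of [1 - 'X] *)

(* The coefficients ['C(m + k, m)] are those of [(1 - 'X) ^- m.+1]. *)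
Lemma coef_div_1subX (m l : nat) (F G : {poly int}) :
  (1 - 'X) ^+ m.+1 * F = G ->
  F`_l = \sum_(0 <= i < l.+1) G`_i * 'C(m + l - i, m)%:Z.
Proof.
elim: m l F G => [|m IHm] l F G.
  rewrite expr1 => FG.
  have GE k : G`_k = F`_k - (if k == 0%N then 0 else F`_k.-1).
    by rewrite -FG mulrBl mul1r coefB coefXM.
  under eq_bigr do rewrite bin0 mulr1.
  elim: l => [|l IHl]; first by rewrite big_nat1 GE subr0.
  by rewrite big_nat_recr //= -IHl GE /= addrC subrK.
(* The induction hypothesis is applied to [(1 - 'X) * F], whose coefficients are the differences of
   consecutive coefficients of [F]. Induction on [l] then sums them by Pascal's rule. *)
rewrite exprSr -mulrA => /(IHm _ _ _) => FG.
elim: l => [|l IHl].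
  have := FG 0%N.
  by rewrite !big_nat1 mulrBl mul1r coefB coefXM subr0 !addn0 !subn0 !binn.
have := FG l.+1; rewrite mulrBl mul1r coefB coefXM /= => /eqP.
rewrite subr_eq => /eqP ->; rewrite IHl.
rewrite [in LHS]big_nat_recr // [in RHS]big_nat_recr //= addrAC -big_split /=.
congr (_ + _); last by rewrite !addnK !binn.
rewrite !big_nat; apply: eq_bigr => i /= il.
rewrite -mulrDr -PoszD; congr (_ * Posz _).
have -> : (m.+1 + l.+1 - i = (m + l.+1 - i).+1)%N by lia.
by rewrite binS addnC addSnnS.
Qed.

(** * The count [W] as a polynomial coefficient *)

Lemma coef_prod_trunc (R : comNzRingType) (J : finType) (F G : J -> {poly R})
    (l : nat) :
  (forall j k, (k <= l)%N -> (F j)`_k = (G j)`_k) ->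
  forall k, (k <= l)%N -> (\prod_j F j)`_k = (\prod_j G j)`_k.
Proof.
move=> FG; elim/big_ind2: _ => [//|p1 p2 q1 q2 p12 q12 k kl|j _];
  last exact: FG.
rewrite !coefM; apply: eq_bigr => i _.
by rewrite p12 ?q12 //; have := ltn_ord i; lia.
Qed.

(** The weights in [wperm] are cut off at [l], which is invisible in the coefficients up to [l]. *)
Lemma coef_sum_Xn (l S k : nat) : (k <= l)%N ->
  (\sum_(v < l.+1 | (v < S)%N) 'X^v : {poly int})`_k =
  (\sum_(v < S) 'X^v : {poly int})`_k.
Proof.
move=> kl; rewrite !coef_sum.
have sumE N (Q : pred nat) : \sum_(v < N | Q v) ('X^v : {poly int})`_k =
    ((k < N)%N && Q k)%:R.
  case: (ltnP k N) => [kN|Nk] /=; last first.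
    rewrite big1 // => v _; rewrite coefXn; case: eqP => // kv.
    by have := ltn_ord v; lia.
  rewrite big_mkcond (bigD1 (Ordinal kN)) //= coefXn eqxx big1 ?addr0.
    by case: (Q k).
  move=> v vk; case: ifP => // _; rewrite coefXn; case: eqP => // kv.
  by move: vk; rewrite -val_eqE /= kv eqxx.
by rewrite (sumE _ (fun v => v < S)%N) (sumE _ xpredT) ltnS kl andbT.
Qed.

Lemma W_coef (n l m : nat) (c : 'I_n -> nat) :
  (W l m c)%:Z = (\sum_(s : 'S_n | #|porbits s| == m)
     \prod_(C in porbits s) \sum_(v < \sum_(i in C) c i) 'X^v : {poly int})`_l.
Proof.
rewrite /W -sum1_card.
transitivity (\sum_(s : 'S_n | #|porbits s| == m)
  \sum_(w : {ffun cycles s -> 'I_l.+1} | compatible c (fun C => w C) &&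
     (total_weight (fun C => w C) == l)) 1 : int).
  rewrite sig_big_dep /= -natz natr_sum; apply: eq_bigl => x.
  by rewrite inE.
rewrite coef_sum; apply: eq_bigr => s _.
rewrite (big_sub (mem (porbits s))) /=.
rewrite -(@coef_prod_trunc _ _ (fun C : cycles s =>
  \sum_(v < l.+1 | (v < \sum_(i in val C) c i)%N) 'X^v) _ l) //; last first.
  by move=> C k kl; apply: coef_sum_Xn.
(* With the bound on [v] turned into a zero term, the product distributes over all functions [w],
   and an incompatible [w] contributes a zero factor. *)
under [in RHS]eq_bigr do rewrite big_mkcond /=.
rewrite bigA_distr_bigA coef_sum big_mkcond; apply: eq_bigr => w _ /=.
rewrite /compatible; case: forallP => [wc|wc] /=.
  rewrite (eq_bigr (fun C => 'X^(w C))) => [|C _]; last by rewrite wc.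
  by rewrite prodrXr coefXn eq_sym; case: eqP.
have /existsP[C /negPf wC] : [exists C, ~~ (w C < \sum_(i in val C) c i)%N].
  by rewrite -negb_forall; apply/forallP.
by rewrite (bigD1 C) //= wC mul0r coef0.
Qed.

(** * Assembly of the formula *)

Lemma mul_1subX_geom (S : nat) :
  (1 - 'X) * (\sum_(v < S) 'X^v) = 1 - 'X^S :> {poly int}.
Proof.
rewrite -[in RHS](expr1n _ S) subrXX.
by under [in RHS]eq_bigr do rewrite expr1n mul1r.
Qed.

(** Here ['X] marks weight and the number of cycles is a filter on [s]; in [sum_stab_porbits], used
    for each fixed [I], ['X] marks cycles instead. *)
Lemma coef_sum_prod_porbits (n m i : nat) (c : 'I_n -> nat) : (m < n)%N ->
  (\sum_(s : 'S_n | #|porbits s| == m.+1)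
     \prod_(C in porbits s) (1 - 'X^(\sum_(r in C) c r)) : {poly int})`_i =
  \sum_(0 <= j < n.+1)
    (-1) ^+ j * P (n - 1 - m) (1 - j%:Z) (n%:Z - 1 - j%:Z) * (rho c j i)%:Z.
Proof.
move=> mn.
under eq_bigr do rewrite prod_porbits_expand.
rewrite (exchange_big_dep xpredT) //= coef_sum.
have term (I : {set 'I_n}) : (\sum_(s : 'S_n | (#|porbits s| == m.+1) &&
      (s \in 'N(I | 'P)%g)) (-1) ^+ #|porbits_in I s| * 'X^(\sum_(r in I) c r) :
      {poly int})`_i =
    (-1) ^+ #|I| * P (n - 1 - m) (1 - #|I|%:Z) (n%:Z - 1 - #|I|%:Z) *
    (\sum_(r in I) c r == i)%N%:R.
  rewrite P_coef //.
  have := sum_stab_porbits I.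
  rewrite [#|~: I|]cardsCs setCK card_ord prod_falling_rising; first last.
  - by rewrite -[X in (_ <= X)%N]card_ord max_card.
  - by apply: leq_ltn_trans mn.
  (* The coefficient of ['X^m.+1] implements the filter on the number of cycles, and the leading
     factor ['X] lowers the index to the [m] of [P_coef]. *)
  move=> /(congr1 (fun p : {poly int} => p`_m.+1)); rewrite coefXM /= => <-.
  rewrite !coef_sum mulr_sumr mulr_suml.
  rewrite big_mkcondl; apply: eq_bigr => s sN.
  rewrite sign_porbits_in //.
  have sgn (b : nat) (p : {poly int}) k : ((-1) ^+ b * p)`_k = (-1) ^+ b * p`_k.
    by rewrite -signr_odd -[in RHS]signr_odd; case: (odd b);
       rewrite ?expr0 ?expr1 ?mul1r ?mulN1r ?coefN.
  rewrite -mulrA !sgn !coefXn [m.+1 == _]eq_sym [i == _]eq_sym.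
  by case: eqP => _ /=; rewrite ?mulr0 ?mul0r ?mulr1 ?mulrA.
rewrite (eq_bigr _ (fun I _ => term I)).
rewrite big_mkord.
rewrite (partition_big
  (fun I : {set 'I_n} => inord #|I| : 'I_n.+1) xpredT) //=.
apply: eq_bigr => j _.
have cardI (I : {set 'I_n}) : (inord #|I| == j) = (#|I| == j :> nat).
  rewrite -val_eqE /= inordK // ltnS.
  by rewrite -[X in (_ <= X)%N]card_ord max_card.
rewrite (eq_bigl _ _ cardI).
rewrite (eq_bigr (fun I : {set 'I_n} => (-1) ^+ j *
  P (n - 1 - m) (1 - j%:Z) (n%:Z - 1 - j%:Z) * (\sum_(r in I) c r == i)%N%:R));
  last by move=> I /eqP ->.
rewrite -mulr_sumr; congr (_ * _).
rewrite /rho -sum1_card -natz natr_sum.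
rewrite [RHS](eq_bigl (fun I : {set 'I_n} =>
    (#|I| == j) && (\sum_(r in I) c r == i)%N));
  last by move=> I; rewrite inE.
by rewrite big_mkcondr; apply: eq_bigr => I _; case: eqP.
Qed.

Theorem theorem3p11 (n : nat) (c : 'I_n -> nat) (hc : forall i, (0 < c i)%N)
    (l m : nat) (hm : (m < n)%N) :
  (W l m.+1 c)%:Z =
  \sum_(0 <= j < n.+1)
    (-1) ^+ j * P (n - 1 - m) (1 - j%:Z) (n%:Z - 1 - j%:Z) *
    \sum_(0 <= i < l.+1) (rho c j i * 'C(m + l - i, m))%N%:Z.
Proof.
rewrite W_coef.
rewrite (@coef_div_1subX m l _ (\sum_(s : 'S_n | #|porbits s| == m.+1)
  \prod_(C in porbits s) (1 - 'X^(\sum_(r in C) c r)))); last first.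
  (* As [s] has [m.+1] cycles, the power of [1 - 'X] supplies one factor to the geometric sum of
     each cycle. *)
  rewrite mulr_sumr; apply: eq_bigr => s /eqP <-.
  rewrite -prodr_const -big_split /=; apply: eq_bigr => C _.
  exact: mul_1subX_geom.
under eq_bigr do rewrite coef_sum_prod_porbits // mulr_suml.
under [RHS]eq_bigr do rewrite mulr_sumr.
rewrite [RHS]exchange_big /=; apply: eq_bigr => i _; apply: eq_bigr => j _.
by rewrite PoszM mulrA.
Qed.
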